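(* Let $\Sigma$ be a signature, $\mathcal{V}$ a set of variables (with $\mathcal{V}\neq\emptyset$ or $\Sigma_0\neq\emptyset$) and $\kappa>0$ a cardinal. Every submultialgebra $\mathcal{A}$ of $\mathbf{mT}(\Sigma,\mathcal{V},\kappa)$ is generated by its ground $G(\mathcal{A})$.
   Context: A signature is a family $\Sigma=\{\Sigma_n\}_{n\in\mathbb{N}}$ ($0\in\mathbb{N}$) of possibly empty sets; elements of $\Sigma_n$ are functional symbols of arity $n$. A $\Sigma$-multialgebra is a pair $\mathcal{A}=(A,\{\sigma_{\mathcal{A}}\}_{\sigma\in\Sigma})$ with $A$ a non-empty set and, for $\sigma\in\Sigma_n$, $\sigma_{\mathcal{A}}:A^n\to\mathcal{P}(A)\setminus\{\emptyset\}$ (for $\sigma\in\Sigma_0$, $\sigma_{\mathcal{A}}$ is identified with a non-empty subset of $A$). $\mathcal{B}$ is a submultialgebra of $\mathcal{A}$ if $B\subseteq A$ and $\sigma_{\mathcal{B}}(b_1,\ldots,b_n)\subseteq\sigma_{\mathcal{A}}(b_1,\ldots,b_n)$ for all $\sigma\in\Sigma_n$, $b_1,\ldots,b_n\in B$. Multialgebras of terms: $T(\Sigma,\mathcal{V})$ is the set of formal terms over $\Sigma$ with variables in $\mathcal{V}$ (the smallest set containing $\mathcal{V}\cup\Sigma_0$ and containing $\sigma\alpha_1\ldots\alpha_n$ whenever $n\ge1$, $\sigma\in\Sigma_n$ and it contains $\alpha_1,\ldots,\alpha_n$; variables and functional symbols are distinct formal symbols). For a cardinal $\kappa>0$, $\Sigma^\kappa$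 is the signature with $\Sigma^\kappa_n=\Sigma_n\times\kappa$, and $(\sigma,\beta)$ is written $\sigma^\beta$. $\mathbf{mT}(\Sigma,\mathcal{V},\kappa)$ is the $\Sigma$-multialgebra with universe $T(\Sigma^\kappa,\mathcal{V})$ and $\sigma_{\mathbf{mT}(\Sigma,\mathcal{V},\kappa)}(\alpha_1,\ldots,\alpha_n)=\{\sigma^\beta\alpha_1\ldots\alpha_n:\beta\in\kappa\}$. The ground of $\mathcal{A}$ is $G(\mathcal{A})=A\setminus\bigcup\{\sigma_{\mathcal{A}}(a_1,\ldots,a_n): n\in\mathbb{N},\sigma\in\Sigma_n,a_1,\ldots,a_n\in A\}$. For $S\subseteq A$: $\langle S\rangle_0=S\cup\bigcup_{\sigma\in\Sigma_0}\sigma_{\mathcal{A}}$, $\langle S\rangle_{m+1}=\langle S\rangle_m\cup\bigcup\{\sigma_{\mathcal{A}}(a_1,\ldots,a_n): n\in\mathbb{N},\sigma\in\Sigma_n,a_1,\ldots,a_n\in\langle S\rangle_m\}$, $\langle S\rangle=\bigcup_m\langle S\rangle_m$; $\mathcal{A}$ is generated by $S$ if $\langle S\rangle=A$. *)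

(* Defs.v *)
From mathcomp Require Import all_boot boolp classical_sets.

Set Implicit Arguments.
Unset Strict Implicit.
Unset Printing Implicit Defensive.

Local Open Scope classical_set_scope.

Definition signature := nat -> Type.

(* The universe is a subset [univ] of an ambient type [U], so that several
   multialgebras, in particular a multialgebra and its submultialgebras, can
   share elements. An n-tuple of elements is a function ['I_n -> U]. The values
   of [op] on tuples that are not entirely in [univ] are meaningless; every
   definition below only applies [op] to tuples of elements of [univ]. *)
Record multialgebra (Sigma : signature) (U : Type) := Multialgebra {
  univ : set U;
  op : forall n, Sigma n -> ('I_n -> U) -> set U;
  univ_neq0 : univ !=set0;
  op_neq0 : forall n (s : Sigma n) (a : 'I_n -> U),
    (forall i, univ (a i)) -> op s a !=set0;
  op_univ : forall n (s : Sigma n) (a : 'I_n -> U),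
    (forall i, univ (a i)) -> op s a `<=` univ
}.
Arguments op {Sigma U} _ {n} _ _ _.

Definition submultialgebra (Sigma : signature) (U : Type)
    (B A : multialgebra Sigma U) : Prop :=
  univ B `<=` univ A /\
  forall n (s : Sigma n) (b : 'I_n -> U),
    (forall i, univ B (b i)) -> op B s b `<=` op A s b.

(* All x in some s_A(a_1, ..., a_n) with a_1, ..., a_n in S. *)
Definition op_values (Sigma : signature) (U : Type) (A : multialgebra Sigma U)
    (S : set U) : set U :=
  [set x | exists (n : nat) (s : Sigma n) (a : 'I_n -> U),
    (forall i, S (a i)) /\ op A s a x].

Definition ground (Sigma : signature) (U : Type) (A : multialgebra Sigma U)
    : set U :=
  univ A `\` op_values A (univ A).

Definition no_arg (U : Type) (i : 'I_0) : U := False_rect U (notF (ltn_ord i)).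

Fixpoint span_step (Sigma : signature) (U : Type) (A : multialgebra Sigma U)
    (S : set U) (m : nat) : set U :=
  if m is m'.+1 then
    span_step A S m' `|` op_values A (span_step A S m')
  else S `|` \bigcup_(s in [set: Sigma 0]) op A s (@no_arg U).

Definition span (Sigma : signature) (U : Type) (A : multialgebra Sigma U)
    (S : set U) : set U :=
  \bigcup_(m in [set: nat]) span_step A S m.

Definition generated_by (Sigma : signature) (U : Type)
    (A : multialgebra Sigma U) (S : set U) : Prop :=
  S `<=` univ A /\ span A S = univ A.

(* The elements of [Sigma 0] appear as terms [App s (@no_arg _)]; by functional
   extensionality this is the only tuple of length 0. *)
Inductive term (Sigma : signature) (V : Type) : Type :=
| Var of V
| App (n : nat) of Sigma n & ('I_n -> term Sigma V).
Arguments Var {Sigma V} _.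
Arguments App {Sigma V n} _ _.

Definition sig_pow (Sigma : signature) (K : Type) : signature :=
  fun n => (Sigma n * K)%type.

Definition mT_op (Sigma : signature) (V K : Type) (n : nat) (s : Sigma n)
    (a : 'I_n -> term (sig_pow Sigma K) V) : set (term (sig_pow Sigma K) V) :=
  [set App ((s, b) : sig_pow Sigma K n) a | b in [set: K]].

Fact mT_univ_neq0 (Sigma : signature) (V K : Type) :
  [set: K] !=set0 -> [set: V] !=set0 \/ [set: Sigma 0] !=set0 ->
  [set: term (sig_pow Sigma K) V] !=set0.
Proof.
case=> b _ [[x _]|[s _]]; first by exists (Var x).
by exists (App ((s, b) : sig_pow Sigma K 0) (@no_arg _)).
Qed.

Fact mT_op_neq0 (Sigma : signature) (V K : Type) :
  [set: K] !=set0 ->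
  forall n (s : Sigma n) (a : 'I_n -> term (sig_pow Sigma K) V),
  (forall i, [set: term (sig_pow Sigma K) V] (a i)) -> mT_op s a !=set0.
Proof.
by case=> b _ n s a _; exists (App ((s, b) : sig_pow Sigma K n) a); exists b.
Qed.

Fact mT_op_univ (Sigma : signature) (V K : Type) n (s : Sigma n)
    (a : 'I_n -> term (sig_pow Sigma K) V) :
  (forall i, [set: term (sig_pow Sigma K) V] (a i)) ->
  mT_op s a `<=` [set: term (sig_pow Sigma K) V].
Proof. by []. Qed.

(* The cardinal kappa is represented by a nonempty type [K] of that
   cardinality, whose elements play the role of the ordinals beta < kappa. *)
Definition mT (Sigma : signature) (V K : Type) (K_neq0 : [set: K] !=set0)
    (VS_neq0 : [set: V] !=set0 \/ [set: Sigma 0] !=set0)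
    : multialgebra Sigma (term (sig_pow Sigma K) V) :=
  {| univ := [set: term (sig_pow Sigma K) V];
     op := @mT_op Sigma V K;
     univ_neq0 := mT_univ_neq0 K_neq0 VS_neq0;
     op_neq0 := mT_op_neq0 K_neq0;
     op_univ := @mT_op_univ Sigma V K |}.
Arguments mT : clear implicits.

(* Main.v *)
Require Import Defs.
From mathcomp Require Import all_boot boolp classical_sets.

Local Open Scope classical_set_scope.

(* In a submultialgebra of mT, an element of A outside the ground is a term
   whose immediate subterms all lie in A; structural induction on terms
   therefore puts every element of A in the span of the ground. *)

Lemma op_values_univ (Sigma : signature) (U : Type) (A : multialgebra Sigma U)
    (S : set U) : S `<=` univ A -> op_values A S `<=` univ A.
Proof.
move=> SA x [n [s [a [aS ax]]]].
by apply: op_univ ax => i; apply: SA; apply: aS.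
Qed.

Lemma span_step_univ (Sigma : signature) (U : Type) (A : multialgebra Sigma U)
    (S : set U) m : S `<=` univ A -> span_step A S m `<=` univ A.
Proof.
move=> SA; elim: m => [|m IHm] x /= [].
- exact: SA.
- by case=> s _; apply: op_univ; case.
- exact: IHm.
- exact: op_values_univ.
Qed.

Lemma span_step_mono (Sigma : signature) (U : Type) (A : multialgebra Sigma U)
    (S : set U) m p : m <= p -> span_step A S m `<=` span_step A S p.
Proof.
move=> /subnK <-; elim: (p - m) => [//|d IHd] x xm.
by left; apply: IHd.
Qed.

(** A tuple has finitely many entries, so one stage of the span, the maximum of their stages,
    contains them all; the value appears at the next stage. *)
Lemma op_values_span (Sigma : signature) (U : Type) (A : multialgebra Sigma U)
    (S : set U) : op_values A (span A S) `<=` span A S.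
Proof.
move=> x [n [s [a [aS ax]]]].
have /choice [m am] : forall i, exists m, span_step A S m (a i).
  by move=> i; have [m _ am] := aS i; exists m.
exists (\max_i m i).+1 => //; right; exists n, s, a; split=> // i.
by apply: span_step_mono (am i); apply: leq_bigmax.
Qed.

Theorem lemma1 (Sigma : signature) (V K : Type)
    (K_neq0 : [set: K] !=set0)
    (VS_neq0 : [set: V] !=set0 \/ [set: Sigma 0] !=set0)
    (A : multialgebra Sigma (term (sig_pow Sigma K) V)) :
  submultialgebra A (mT Sigma V K K_neq0 VS_neq0) ->
  generated_by A (ground A).
Proof.
move=> [_ opA]; have gA : ground A `<=` univ A by move=> x [].
split=> //; apply/seteqP; split=> [x [m _]|]; first exact: span_step_univ.
have ground_span : ground A `<=` span A (ground A).
  by move=> x gx; exists 0 => //; left.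
(* Membership in [A] stays a premise of the induction: a ground term may have subterms outside
   [A]. *)
elim=> [v|n s a IHa] tA.
  (* Operation values in [A] are also values in [mT], hence [App] terms, never variables. *)
  apply: ground_span; split=> // -[n [s [a [aA /(opA _ _ _ aA)]]]].
  by case.
have [[m [r [c [cA cx]]]]|tN] := pselect (op_values A (univ A) (App s a));
  last exact: ground_span.
apply: op_values_span; exists m, r, c; split=> // i.
have [b _ E] := opA _ _ _ cA _ cx.
(* A match on the term lets [E] be rewritten without inverting a dependent
   equality. *)
pose P t := if t is App _ _ d
  then forall i, univ A (d i) -> span A (ground A) (d i) else True.
have : P (App s a) by [].
(* Rewriting with [E] carries [IHa] from [a] over to [c], whose entries lie in [A] by [cA]. *)
by rewrite -E; apply.
Qed.
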